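(* Let $N,m,n,d\ge1$ be integers and let $a_{ij}^\lambda\in\mathbb{C}$ for $1\le i\le m$, $1\le j\le n$, $1\le\lambda\le N$. Let $F:\mathbb{C}^N\to M_{mn}$ be the matrix with entries $$F(x)_{ij}=a_{ij}^1x_1^d+\cdots+a_{ij}^Nx_N^d,$$ and let $L$ be the associated linear matrix, in the variables $u_\lambda=x_\lambda^d$, $\lambda=1,\ldots,N$, with entries $$L(u)_{ij}=a_{ij}^1u_1+\cdots+a_{ij}^Nu_N .$$ Write $L_\lambda=\frac{\partial L}{\partial u_\lambda}$. Suppose that $L$ is an EIDS and that the following condition holds for $L$: $$\mathcal{O}_N\{u_\lambda L_\lambda(u),\,R_{lk}(u),\,C_{pq}(u)\}\supseteq \mathfrak{m}_N^r\,\mathcal{O}_N^{mn}$$ for some natural number $r$, where the left-hand side is the $\mathcal{O}_N$-submodule of $\mathcal{O}_N^{mn}$ generated by the indicated matrices for $1\le\lambda\le N$, $1\le l,k\le m$, $1\le p,q\le n$. Then $F$ is an EIDS.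
   Context: $M_{mn}\cong\mathbb{C}^{mn}$ is the space of complex $m\times n$ matrices, and $M_{mn}^t\subset M_{mn}$ is the subset of matrices of rank less than $t$ (with $M_{mn}^0=\emptyset$). In the displayed condition, $\mathcal{O}_N$ is the ring of germs at $0$ of analytic functions in the variables $u_1,\ldots,u_N$, $\mathfrak{m}_N$ is its maximal ideal, and $\mathcal{O}_N^{mn}$ is identified with the module of $m\times n$ matrices with entries in $\mathcal{O}_N$. $C_{pq}(u)$ (respectively $R_{lk}(u)$) denotes the $m\times n$ matrix whose $p$-th column (respectively $l$-th row) equals the $q$-th column (respectively the $k$-th row) of $L(u)$, with zeros elsewhere. EIDS: the strata of $M_{mn}^t$ are $M_{mn}^i\setminus M_{mn}^{i-1}$, $1\le i\le t$. A holomorphic map germ $H:(\mathbb{C}^N,0)\to M_{mn}$ is said to be (or define) an EIDS (essentially isolated determinantal singularity) if $H^{-1}(M_{mn}^t)$ is an EIDS at the origin for all $1\le t\le\min\{m,n\}$, that is, if $H$ is transverse to all the strata $M_{mn}^i\setminus M_{mn}^{i-1}$, $1\le i\le\min\{m,n\}$, in a punctured neighbourhood of the origin in $\mathbb{C}^N$. *)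

(* Defs.v *)
From HB Require Import structures.
From mathcomp Require Import all_boot all_order all_algebra.
From mathcomp Require Import finmap complex.
From mathcomp Require Import all_classical all_reals all_analysis.
From mathcomp.analysis.showcase Require Import summability.

Set Implicit Arguments.
Unset Strict Implicit.
Unset Printing Implicit Defensive.

Import Order.TTheory GRing.Theory Num.Theory.
Import numFieldNormedType.Exports.

Local Open Scope classical_set_scope.
Local Open Scope ring_scope.

(* The complex numbers.  Naming the [numFieldType] lets the metric topology
   induced by the modulus be inferred on C, C^N and the matrix spaces. *)
Definition Cplx (R : realType) : numFieldType := R[i].

(* Germs at the origin of C^N are represented by total functions on C^N, and
   equality of germs is equality near 0. *)

Definition monomial (K : numFieldType) (N : nat) (al : {ffun 'I_N -> nat})
    (u : 'cV[K]_N) : K := \prod_(l < N) u l 0 ^+ al l.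

(* The function f is the sum, near 0, of a power series in N variables.  The
   multi-index series is summed unconditionally, along finite sets of
   multi-indices, so convergence is absolute. *)
Definition analytic (R : realType) (N : nat) (f : 'cV[Cplx R]_N -> Cplx R) :=
  exists c : {ffun 'I_N -> nat} -> Cplx R,
    \forall u \near (0 : 'cV[Cplx R]_N),
      partial_sum (fun al => c al * monomial al u) @ totally --> f u.

Definition max_ideal (R : realType) (N : nat) (f : 'cV[Cplx R]_N -> Cplx R) :=
  analytic f /\ f 0 = 0.

(* The O_N-submodule generated by a set G of germs with values in V. *)
Definition O_span (R : realType) (N : nat) (V : lmodType (Cplx R))
    (G : set ('cV[Cplx R]_N -> V)) : set ('cV[Cplx R]_N -> V) :=
  [set h | exists (k : nat) (c : 'I_k -> 'cV[Cplx R]_N -> Cplx R)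
      (g : 'I_k -> 'cV[Cplx R]_N -> V),
    [/\ forall s, analytic (c s), forall s, G (g s) &
      \forall u \near (0 : 'cV[Cplx R]_N), h u = \sum_(s < k) c s u *: g s u]].

(* The ideal power m_N^r (all of O_N when r = 0). *)
Definition max_ideal_pow (R : realType) (N r : nat) :
    set ('cV[Cplx R]_N -> Cplx R) :=
  @O_span R N (Cplx R)^o
    [set f | exists g : 'I_r -> 'cV[Cplx R]_N -> Cplx R,
      (forall s, max_ideal (g s)) /\ f = (fun u => \prod_(s < r) g s u)].

Definition analytic_mx (R : realType) (N m n : nat)
    (E : 'cV[Cplx R]_N -> 'M[Cplx R]_(m, n)) :=
  forall i j, analytic (fun u => E u i j).

(* m_N^r O_N^{mn} *)
Definition max_ideal_pow_mx (R : realType) (N m n r : nat) :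
    set ('cV[Cplx R]_N -> 'M[Cplx R]_(m, n)) :=
  O_span [set h | exists f E,
    [/\ @max_ideal_pow R N r f, analytic_mx E & h = (fun u => f u *: E u)]].

(* C_{pq}: its p-th column is the q-th column of A, the others vanish. *)
Definition col_to (K : numFieldType) (m n : nat) (p q : 'I_n)
    (A : 'M[K]_(m, n)) : 'M[K]_(m, n) :=
  \matrix_(i, j) (if j == p then A i q else 0).

(* R_{lk}: its l-th row is the k-th row of A, the others vanish. *)
Definition row_to (K : numFieldType) (m n : nat) (l k : 'I_m)
    (A : 'M[K]_(m, n)) : 'M[K]_(m, n) :=
  \matrix_(i, j) (if i == l then A k j else 0).

(* [delta_mx l 0] is the l-th vector of the standard basis of C^N, so that the
   directional derivative along it is the partial derivative in u_l. *)
Definition partial_mx (R : realType) (N m n : nat)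
    (L : 'cV[Cplx R]_N -> 'M[Cplx R]_(m, n)) (l : 'I_N) :
    'cV[Cplx R]_N -> 'M[Cplx R]_(m, n) :=
  fun u => 'D_(delta_mx l 0) L u.

Definition gens (R : realType) (N m n : nat)
    (L : 'cV[Cplx R]_N -> 'M[Cplx R]_(m, n)) :
    set ('cV[Cplx R]_N -> 'M[Cplx R]_(m, n)) :=
  [set h | (exists l : 'I_N, h = (fun u : 'cV_N => u l 0 *: partial_mx L l u)) \/
           (exists l k : 'I_m, h = (fun u => row_to l k (L u))) \/
           (exists p q : 'I_n, h = (fun u => col_to p q (L u)))].

(* The tangent space at A of a complex submanifold S: the velocities at 0 of
   the germs of holomorphic curves in S through A. *)
Definition tangent (K : numFieldType) (V : normedModType K) (S : set V)
    (A : V) : set V :=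
  [set v | exists g : K -> V,
    [/\ \forall t \near (0 : K), derivable g t 1,
        \forall t \near (0 : K), S (g t), g 0 = A & 'D_1 g 0 = v]].

Definition transverse_at (K : numFieldType) (U V : normedModType K)
    (H : U -> V) (S : set V) (x : U) :=
  S (H x) -> forall B : V, exists w v, tangent S (H x) v /\ B = 'd H x w + v.

Definition rank_lt (K : numFieldType) (m n t : nat) : set 'M[K]_(m, n) :=
  [set A | (\rank A < t)%N].

Definition is_EIDS (R : realType) (N m n : nat)
    (H : 'cV[Cplx R]_N -> 'M[Cplx R]_(m, n)) :=
  (\forall x \near (0 : 'cV[Cplx R]_N), differentiable H x) /\
  \forall x \near (0 : 'cV[Cplx R]_N)^', forall i : nat,
    (1 <= i <= minn m n)%N ->
    transverse_at H (@rank_lt (Cplx R) m n i `\` @rank_lt (Cplx R) m n i.-1) x.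

(* Main.v *)
Require Import Defs.
From HB Require Import structures.
From mathcomp Require Import all_boot all_order all_algebra.
From mathcomp Require Import finmap complex.
From mathcomp Require Import all_classical all_reals all_analysis.
From mathcomp.analysis.showcase Require Import summability.

Set Implicit Arguments.
Unset Strict Implicit.
Unset Printing Implicit Defensive.

Import Order.TTheory GRing.Theory Num.Theory.
Import numFieldNormedType.Exports.

Local Open Scope classical_set_scope.
Local Open Scope ring_scope.

(** Write [A l] for the coefficient matrices, so that [L u] is the sum of the
[u l *: A l] and [F x = L (phi x)], where [phi] raises each coordinate to the
power [d].  At a point [x] with [u = phi x], the image of the differential of
[F] contains, for each [l], the vector [x l ^ d *: A l = u l *: A l]: it is the
image of [x l / d] times the [l]-th basis vector.  When [d > 1] and [u l = 0],
the [l]-th direction contributes nothing, whereas the differential of [L] always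
reaches [A l]; so the differential of [F] can be strictly weaker.

The tangent space at [L u] of the stratum of matrices of constant rank contains
every [P L(u) + L(u) Q], the velocity of the curve [(1 + tP) L(u) (1 + tQ)]
([tangent_two_sided]).  Hence transversality of [F] at [x] follows if every
matrix lies in the space [log_tangent A u] spanned by the [u l *: A l] and the
[P L(u) + L(u) Q].  This is the linear span of the values at [u] of the
generators [u_l L_l], [R_lk] and [C_pq], as [R_lk] and [C_pq] are the products
of [L] by elementary matrices on the left and on the right.

The algebraic condition supplies this near the origin.  For each coordinate [l]
and each elementary matrix [E], the germ [u l ^ r *: E] lies in the [r]-th power
of the maximal ideal times the free module, hence is an [O_N]-combination of
the generators; evaluating at [u] puts [u l ^ r *: E] in [log_tangent A u].
When [u] is nonzero some [u l] is invertible, so every elementary matrix is in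
[log_tangent A u], and thus every matrix ([near_log_tangent_full]).  There are
finitely many pairs of [l] and [E], so one neighbourhood serves them all.
Finally [phi] is continuous, fixes the origin and sends nonzero points to
nonzero points. *)

(** * Differentials of power sums *)

Section PowerSums.
Context {K : numFieldType} {N m n : nat}.
Implicit Types (A : 'I_N -> 'M[K]_(m, n)) (x w : 'cV[K]_N).

(** With [A l] the coefficient matrices, exponent [d] gives [F] and exponent [1]
gives [L].  Taking for [A l] the basis vectors of [K^N] gives the substitution
[x |-> x^d], so that its continuity needs no separate argument. *)
Definition power_sum A d x : 'M[K]_(m, n) := \sum_(l < N) x l 0 ^+ d *: A l.

Lemma is_diff_coordX d l x :
  is_diff x (fun y : 'cV[K]_N => y l 0 ^+ d.+1 : K)
    (fun w => d.+1%:R * x l 0 ^+ d * w l 0).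
Proof.
pose c := fun y : 'cV[K]_N => y l 0.
have dc : is_diff x c c.
  apply: DiffDef; first exact: differentiable_coord.
  have @f : {linear 'cV[K]_N -> K}.
    by exists c; do 2![eexists]; do ?[constructor];
       rewrite /c ?mxE// => ? *; rewrite ?mxE//; move=> ?; rewrite !mxE.
  have -> : c = f by [].
  by apply: diff_lin; exact: coord_continuous.
have [dX dXE] := is_diffX d dc; move: dX dXE; rewrite exprfctE => dX dXE.
by apply: DiffDef.
Qed.

Lemma is_diff_power_sum A d x :
  is_diff x (power_sum A d.+1)
    (fun w => \sum_(l < N) (d.+1%:R * x l 0 ^+ d * w l 0) *: A l).
Proof.
have -> : power_sum A d.+1 =
    \sum_(l < N) (fun y : 'cV[K]_N => y l 0 ^+ d.+1 *: A l).
  by apply/funext => y; rewrite /power_sum fct_sumE.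
have -> : (fun w : 'cV[K]_N =>
      \sum_(l < N) (d.+1%:R * x l 0 ^+ d * w l 0) *: A l) =
    \sum_(l < N) (fun w : 'cV[K]_N => (d.+1%:R * x l 0 ^+ d * w l 0) *: A l).
  by apply/funext => w; rewrite fct_sumE.
elim/big_ind2 : _ => [|f f' g g' df dg|l _].
- exact: is_diff_cst.
- exact: is_diffD.
- have [dX dXE] := is_diff_coordX d l x.
  apply: DiffDef; first exact: differentiableZl.
  by rewrite diffZl// dXE.
Qed.

Lemma power_sum_continuous A d : continuous (power_sum A d.+1).
Proof.
move=> x; apply: differentiable_continuous.
by have [] := is_diff_power_sum A d x.
Qed.

End PowerSums.

(** * Tangent vectors to the manifolds of matrices of fixed rank *)

Lemma det_continuous {K : numFieldType} {T : topologicalType} {n : nat}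
    (M : T -> 'M[K]_n) :
  (forall i j, continuous (fun t => M t i j)) -> continuous (fun t => \det (M t)).
Proof.
move=> cM; rewrite /determinant.
apply: continuous_big => [|s _]; first exact: add_continuous.
move=> t; apply: cvgM; first exact: cvg_cst.
move: t; apply: continuous_big => [|i _]; first exact: mul_continuous.
exact: cM.
Qed.

Lemma near_unitmx_1addZ {K : numFieldType} n (P : 'M[K]_n) :
  \forall t \near (0 : K), 1%:M + t *: P \in unitmx.
Proof.
pose f t := \det (1%:M + t *: P).
have cf : continuous f.
  apply: det_continuous => i j t.
  have -> : (fun s : K => (1%:M + s *: P) i j) =
      (fun s => (1%:M : 'M[K]_n) i j + s * P i j).
    by apply/funext => s; rewrite !mxE.
  apply: (@cvgD _ _ _ (nbhs t) _ (cst _) (fun s => s * P i j)).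
    by apply: cvg_cst.
  by apply: cvgM; [exact: cvg_id|apply: cvg_cst].
have f0 : f 0 != 0 by rewrite /f scale0r addr0 det1 oner_neq0.
have nz : \forall t \near (0 : K), f t != 0 by apply: cvgr_neq0 (cf 0) f0.
by apply: filterS nz => t; rewrite unitmxE unitfE.
Qed.

Section TangentRank.
Context {K : numFieldType} {m n : nat}.
Implicit Types (A : 'M[K]_(m, n)) (S : set 'M[K]_(m, n)).

(** The witness is the curve [(1 + tP) A (1 + tQ)]: its outer factors are
invertible for small [t], so it stays among the matrices of the rank of [A]. *)
Lemma tangent_two_sided S A (P : 'M[K]_m) (Q : 'M[K]_n) :
  (forall B, \rank B = \rank A -> S B) -> tangent S A (P *m A + A *m Q).
Proof.
move=> SA.
pose g (t : K) : 'M[K]_(m, n) := (1%:M + t *: P) *m A *m (1%:M + t *: Q).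
have gE : g = cst A + *:%R^~ (P *m A + A *m Q) +
              (fun t => (t ^+ 2) *: (P *m A *m Q)).
  apply/funext => t; rewrite /g !fctE.
  rewrite mulmxDl mul1mx -scalemxAl mulmxDr mulmx1 -scalemxAr mulmxDl.
  by rewrite -scalemxAl !scalerDr scalerA -expr2 !addrA.
have dg (t : K) : is_derive t (1 : K) g
    (P *m A + A *m Q + (t *+ 2) *: (P *m A *m Q)).
  have [] := is_diffX 1 (is_diff_id t); rewrite exprfctE => e2 e2E.
  have dq : is_diff t (fun s : K => s ^+ 2 *: (P *m A *m Q))
      (fun v => (2%:R * t ^+ 1 * v) *: (P *m A *m Q)).
    apply: DiffDef; first exact: differentiableZl.
    by rewrite diffZl// e2E.
  have [h hE] : is_diff t g (cst 0 + *:%R^~ (P *m A + A *m Q) +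
      (fun v => (2%:R * t ^+ 1 * v) *: (P *m A *m Q))).
    rewrite gE.
    exact: (is_diffD (is_diffD (is_diff_cst A t) (is_diff_scalel t _)) dq).
  apply: DeriveDef; first exact: diff_derivable.
  by rewrite deriveE// hE !fctE /= add0r scale1r expr1 mulr1 mulr_natl.
exists g; split.
- by near=> t; have [] := dg t.
- near=> t; apply: SA.
  have Pt : 1%:M + t *: P \in unitmx by near: t; exact: near_unitmx_1addZ.
  have Qt : 1%:M + t *: Q \in unitmx by near: t; exact: near_unitmx_1addZ.
  by rewrite mxrankMfree ?row_free_unit// eqmxMfull ?row_full_unit.
- by rewrite /g !scale0r !addr0 mul1mx mulmx1.
- by have [_ ->] := dg 0; rewrite mul0rn scale0r addr0.
Unshelve. all: by end_near. Qed.

End TangentRank.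

(** * Membership in powers of the maximal ideal *)

Lemma analytic_term (R : realType) (N : nat) (b : Cplx R)
    (al : {ffun 'I_N -> nat}) :
  analytic (fun u : 'cV[Cplx R]_N => b * monomial al u).
Proof.
exists (fun be => if be == al then b else 0).
near=> u; apply: cvg_near_cst.
  exact: totally_filter.
exists [fset al]%fset => //= J /fsubsetP/(_ al); rewrite !inE eqxx.
move=> /(_ isT) alJ; rewrite /partial_sum.
rewrite (bigD1 [` alJ]%fset)//= eqxx big1 ?addr0// => i.
by rewrite -val_eqE /= => /negbTE ->; rewrite mul0r.
Unshelve. all: by end_near. Qed.

Lemma analytic_cst (R : realType) (N : nat) (b : Cplx R) :
  analytic (fun _ : 'cV[Cplx R]_N => b).
Proof.
have := @analytic_term R N b [ffun=> 0%N]; congr analytic.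
apply/funext => u; rewrite /monomial big1 ?mulr1// => l _.
by rewrite ffunE expr0.
Qed.

Lemma analytic_coord (R : realType) (N : nat) (l : 'I_N) :
  analytic (fun u : 'cV[Cplx R]_N => u l 0).
Proof.
have := @analytic_term R N 1 [ffun k => (k == l) : nat]; congr analytic.
apply/funext => u; rewrite /monomial mul1r (bigD1 l)//= ffunE eqxx expr1.
by rewrite big1 ?mulr1// => k /negbTE kl; rewrite ffunE kl expr0.
Qed.

Lemma O_span_gen (R : realType) (N : nat) (V : lmodType (Cplx R))
    (G : set ('cV[Cplx R]_N -> V)) h : G h -> O_span G h.
Proof.
move=> Gh; exists 1%N, (fun _ _ => 1), (fun _ => h); split => //.
  by move=> _; exact: analytic_cst.
by near=> u; rewrite big_ord1 scale1r.
Unshelve. all: by end_near. Qed.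

(** These germs are the only elements of the [r]-th power of the ideal on which
the condition has to be tested: at a nonzero point one of them, for each [B],
takes a nonzero multiple of [B] as value. *)
Lemma max_ideal_pow_mx_coordX (R : realType) (N m n r : nat) (l : 'I_N)
    (B : 'M[Cplx R]_(m, n)) :
  max_ideal_pow_mx r (fun u : 'cV[Cplx R]_N => u l 0 ^+ r *: B).
Proof.
apply: O_span_gen; exists (fun u => u l 0 ^+ r), (fun _ => B); split => //.
  apply: O_span_gen; exists (fun _ u => u l 0); split.
    by move=> _; split; [exact: analytic_coord|rewrite mxE].
  by apply/funext => u; rewrite prodr_const card_ord.
by move=> i j; exact: analytic_cst.
Qed.

(** * The values of the generators at a point *)

Section LogTangent.
Context {K : numFieldType} {N m n : nat}.
Variable A : 'I_N -> 'M[K]_(m, n).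

(** The sum of the span of the [u l *: A l] (velocities of the linear matrix
along vector fields tangent to all the coordinate hyperplanes) and the tangent
space at [L u] to its orbit under row and column operations. *)
Definition log_tangent (u : 'cV[K]_N) : set 'M[K]_(m, n) :=
  [set B | exists (c : 'I_N -> K) (P : 'M[K]_m) (Q : 'M[K]_n),
    B = \sum_(l < N) (c l * u l 0) *: A l +
        (P *m power_sum A 1 u + power_sum A 1 u *m Q)].

Lemma log_tangent0 u : log_tangent u 0.
Proof.
exists (fun _ => 0), 0, 0; rewrite mul0mx mulmx0 !addr0 big1// => l _.
by rewrite mul0r scale0r.
Qed.

Lemma log_tangentD u B B' :
  log_tangent u B -> log_tangent u B' -> log_tangent u (B + B').
Proof.
move=> [c [P [Q ->]]] [c' [P' [Q' ->]]].
exists (fun l => c l + c' l), (P + P'), (Q + Q').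
rewrite addrACA -big_split/= mulmxDl mulmxDr [in RHS]addrACA; congr (_ + _).
by apply: eq_bigr => l _; rewrite mulrDl scalerDl.
Qed.

Lemma log_tangentZ u k B : log_tangent u B -> log_tangent u (k *: B).
Proof.
move=> [c [P [Q ->]]]; exists (fun l => k * c l), (k *: P), (k *: Q).
rewrite !scalerDr scaler_sumr -scalemxAl -scalemxAr; congr (_ + _).
by apply: eq_bigr => l _; rewrite scalerA mulrA.
Qed.

Lemma log_tangent_sum u I (s : seq I) (F : I -> 'M[K]_(m, n)) :
  (forall i, log_tangent u (F i)) -> log_tangent u (\sum_(i <- s) F i).
Proof.
move=> tF; elim/big_ind : _ => // [|B B'].
  exact: log_tangent0.
exact: log_tangentD.
Qed.

Lemma log_tangent_scaled_slice u l : log_tangent u (u l 0 *: A l).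
Proof.
exists (fun k => (k == l)%:R), 0, 0; rewrite mul0mx mulmx0 !addr0.
rewrite (bigD1 l)//= eqxx mul1r big1 ?addr0// => k /negbTE ->.
by rewrite mul0r scale0r.
Qed.

Lemma log_tangent_mulmx u (P : 'M[K]_m) (Q : 'M[K]_n) :
  log_tangent u (P *m power_sum A 1 u + power_sum A 1 u *m Q).
Proof.
exists (fun _ => 0), P, Q; rewrite big1 ?add0r// => l _.
by rewrite mul0r scale0r.
Qed.

End LogTangent.

Lemma row_toE (K : numFieldType) m n (l k : 'I_m) (A : 'M[K]_(m, n)) :
  row_to l k A = delta_mx l k *m A.
Proof.
apply/matrixP => i j; rewrite !mxE (bigD1 k)//= mxE eqxx andbT big1 ?addr0.
  by case: (i == l); rewrite ?mul1r ?mul0r.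
by move=> k' /negbTE k'k; rewrite mxE k'k andbF mul0r.
Qed.

Lemma col_toE (K : numFieldType) m n (p q : 'I_n) (A : 'M[K]_(m, n)) :
  col_to p q A = A *m delta_mx q p.
Proof.
apply/matrixP => i j; rewrite !mxE (bigD1 q)//= mxE eqxx /= big1 ?addr0.
  by case: (j == p); rewrite ?mulr1 ?mulr0.
by move=> k' /negbTE k'k; rewrite mxE k'k mulr0.
Qed.

(** * The algebraic condition at nonzero points *)

Section Condition.
Context {R : realType} {N m n : nat}.
Variable A : 'I_N -> 'M[Cplx R]_(m, n).

Lemma partial_power_sum1 (l : 'I_N) u : partial_mx (power_sum A 1) l u = A l.
Proof.
have [dL dLE] := is_diff_power_sum A 0 u.
rewrite /partial_mx deriveE// dLE (bigD1 l)//= big1 ?addr0.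
  by rewrite expr0 !mulr1 mxE !eqxx mulr1 scale1r.
by move=> k /negbTE kl; rewrite mxE kl mulr0 scale0r.
Qed.

Lemma gens_log_tangent h u : gens (power_sum A 1) h -> log_tangent A u (h u).
Proof.
case=> [[l ->]|[[l [k ->]]|[p [q ->]]]].
- by rewrite partial_power_sum1; exact: log_tangent_scaled_slice.
- rewrite row_toE -[X in log_tangent _ _ X]addr0 -(mulmx0 _ (power_sum A 1 u)).
  exact: log_tangent_mulmx.
- rewrite col_toE -[X in log_tangent _ _ X]add0r -(mul0mx _ (power_sum A 1 u)).
  exact: log_tangent_mulmx.
Qed.

(** The condition, stated for germs, becomes a statement about the fibre at each
nearby point; away from the origin, the power of the maximal ideal is
invisible in the fibre. *)
Lemma near_log_tangent_full r :
  @max_ideal_pow_mx R N m n r `<=` O_span (gens (power_sum A 1)) ->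
  \forall u \near (0 : 'cV[Cplx R]_N), u != 0 -> forall B, log_tangent A u B.
Proof.
move=> cond.
have : \forall u \near (0 : 'cV[Cplx R]_N), forall l i j,
    log_tangent A u (u l 0 ^+ r *: delta_mx i j).
  pose nbhs0 := nbhs (0 : 'cV[Cplx R]_N).
  refine (@filter_forall _ _ _ nbhs0 _ _) => l.
  refine (@filter_forall _ _ _ nbhs0 _ _) => i.
  refine (@filter_forall _ _ _ nbhs0 _ _) => j.
  have [k [c [g [_ Gg]]]] := cond _ (max_ideal_pow_mx_coordX r l (delta_mx i j)).
  apply: filterS => u ->; apply: log_tangent_sum => s.
  by apply: log_tangentZ; exact: gens_log_tangent.
apply: filterS => u tu /cV0Pn[l ul0] B.
rewrite (matrix_sum_delta B); apply: log_tangent_sum => i.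
apply: log_tangent_sum => j; apply: log_tangentZ.
rewrite -[delta_mx i j]scale1r -(mulVf (expf_neq0 r ul0)) -scalerA.
by apply: log_tangentZ; exact: tu.
Qed.

End Condition.

(** * Transversality of the pulled-back matrix *)

Theorem proposition4p1 (R : realType) (N m n d : nat)
    (hN : (1 <= N)%N) (hm : (1 <= m)%N) (hn : (1 <= n)%N) (hd : (1 <= d)%N)
    (a : 'I_m -> 'I_n -> 'I_N -> Cplx R)
    (F L : 'cV[Cplx R]_N -> 'M[Cplx R]_(m, n))
    (hF : forall x i j, F x i j = \sum_(l < N) a i j l * x l 0 ^+ d)
    (hL : forall u i j, L u i j = \sum_(l < N) a i j l * u l 0)
    (hLE : is_EIDS L)
    (hcond : exists r : nat, @max_ideal_pow_mx R N m n r `<=` O_span (gens L)) :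
  is_EIDS F.
Proof.
pose A l : 'M[Cplx R]_(m, n) := \matrix_(i, j) a i j l.
case: d hd hF => // d _ hF.
have FE : F = power_sum A d.+1.
  apply/funext => x; apply/matrixP => i j; rewrite hF summxE.
  by apply: eq_bigr => l _; rewrite !mxE mulrC.
have LE : L = power_sum A 1.
  apply/funext => x; apply/matrixP => i j; rewrite hL summxE.
  by apply: eq_bigr => l _; rewrite !mxE mulrC expr1.
move: hcond => [r]; rewrite LE => /near_log_tangent_full full.
pose phi : 'cV[Cplx R]_N -> 'cV[Cplx R]_N :=
  power_sum (fun l => delta_mx l 0) d.+1.
have phiE x l : phi x l 0 = x l 0 ^+ d.+1.
  rewrite summxE (bigD1 l)//= !mxE !eqxx mulr1 big1 ?addr0// => k /negbTE kl.
  by rewrite !mxE eq_sym kl mulr0.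
have FphiE x : F x = power_sum A 1 (phi x).
  by rewrite FE; apply: eq_bigr => l _; rewrite phiE expr1.
have phi0 : phi 0 = 0.
  by apply/matrixP => l j; rewrite ord1 phiE !mxE expr0n.
have phi_neq0 x : x != 0 -> phi x != 0.
  by move=> /cV0Pn[l xl0]; apply/cV0Pn; exists l; rewrite phiE expf_neq0.
have diffF x w :
    'd F x w = \sum_(l < N) (d.+1%:R * x l 0 ^+ d * w l 0) *: A l.
  by have [_ dE] := is_diff_power_sum A d x; rewrite FE dE.
split.
  by near=> x; rewrite FE; have [] := is_diff_power_sum A d x.
have : \forall x \near (0 : 'cV[Cplx R]_N), phi x != 0 ->
    forall B, log_tangent A (phi x) B.
  have cphi : phi x @[x --> (0 : 'cV[Cplx R]_N)] --> (0 : 'cV[Cplx R]_N).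
    by rewrite -[X in _ --> X]phi0; exact: power_sum_continuous.
  exact: (cphi _ full).
move=> /nbhs_dnbhs near_tphi; near=> x => i _ SFx B.
have x0 : x != 0 by near: x; exact: nbhs_dnbhs_neq.
have [c [P [Q BE]]] : log_tangent A (phi x) B.
  by apply: (near near_tphi x _) => //; exact: phi_neq0.
(* The [l]-th entry solves [d.+1 * x_l ^+ d * w_l = c_l * u_l], where
   [u_l = x_l ^+ d.+1]. *)
exists (\col_l (c l * x l 0 / d.+1%:R)), (P *m F x + F x *m Q); split.
  apply: tangent_two_sided => C rC.
  by move: SFx; rewrite /rank_lt /= rC.
rewrite diffF BE -FphiE; congr (_ + _); apply: eq_bigr => l _; congr (_ *: _).
by rewrite mxE phiE [RHS]mulrC mulrA mulfVK ?pnatr_eq0// exprS mulrA.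
Unshelve. all: by end_near. Qed.
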